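(* Let $m$, $n$, $r$, $u$ and $v$ be non-negative integers. If $\{(s_k),(\sigma_k)\}$ and $\{(t_k),(\tau_k)\}$, $k=0,1,2,\ldots$, are binomial-transform pairs of the first kind, then \[ \sum_{k=0}^n(-1)^k\binom nk\sum_{p=0}^r(-1)^p\binom rp s_{n-k+p+m}\sum_{j=0}^u(-1)^j\binom uj t_{k+j+v} =\sum_{k=0}^n(-1)^k\binom nk\sum_{p=0}^m(-1)^p\binom mp\sigma_{k+p+r}\sum_{j=0}^v(-1)^j\binom vj\tau_{n-k+j+u}. \]
   Context: Two sequences $(s_k)_{k\ge0}$ and $(\sigma_k)_{k\ge0}$ of complex numbers form a binomial-transform pair of the first kind if $\sigma_n=\sum_{k=0}^n(-1)^k\binom nk s_k$ for every non-negative integer $n$. *)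

(* Defs.v *)
From HB Require Import structures.
From mathcomp Require Export all_boot all_order all_algebra.
From mathcomp Require Export reals complex.

Set Implicit Arguments.
Unset Strict Implicit.
Unset Printing Implicit Defensive.

Import GRing.Theory.
Local Open Scope ring_scope.
Local Open Scope complex_scope.

Definition binomial_transform_pair_first_kind (R : realType) (s sigma : nat -> R[i]) : Prop :=
  forall n : nat,
    sigma n = \sum_(0 <= k < n.+1) (-1) ^+ k * 'C(n, k)%:R * s k.

(* Main.v *)
(** Umbral proof. Let [L_s] be the linear functional on polynomials with
    [L_s(x^k) = s_k]; then [(s, sigma)] is a binomial-transform pair exactly when
    [sigma_k = L_s((1 - x)^k)]. Both sides of the identity are the value of
    [L_s (x) L_t] on the bivariate polynomial
    [x^m (1 - x)^r y^v (1 - y)^u (x - y)^n]: the left side expands the last factor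
    as [(x - y)^n], the right side as [((1 - y) - (1 - x))^n]. *)

From HB Require Import structures.
Require Import Defs.
From mathcomp Require Import all_boot all_order all_algebra.
From mathcomp Require Import reals complex.

Import GRing.Theory.
Local Open Scope ring_scope.
Local Open Scope complex_scope.

Lemma exprBn_nat (A : comPzRingType) (x y : A) (n : nat) :
  (x - y) ^+ n =
  \sum_(0 <= k < n.+1) (-1) ^+ k * 'C(n, k)%:R * (x ^+ (n - k) * y ^+ k).
Proof.
rewrite exprBn big_mkord; apply: eq_bigr => k _.
by rewrite -mulr_natr -!mulrA; congr (_ * _); rewrite mulrA mulrC.
Qed.

Section Umbral.

Context {K : comNzRingType}.

Definition umbral (s : nat -> K) (p : {poly K}) : K :=
  \sum_(i < size p) p`_i * s i.

(** Coefficients beyond the size vanish. Linearity needs this, since [p], [q] and [a *: p + q] must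
    be summed over one common range. *)
Lemma umbral_widen (s : nat -> K) (p : {poly K}) (N : nat) :
  (size p <= N)%N -> umbral s p = \sum_(i < N) p`_i * s i.
Proof.
move=> le_pN; rewrite /umbral (big_ord_widen N (fun i => p`_i * s i)) //.
rewrite big_mkcond; apply: eq_bigr => i _; case: ltnP => // /leq_sizeP-> //.
by rewrite mul0r.
Qed.

Lemma umbral_is_linear (s : nat -> K) : scalar (umbral s).
Proof.
move=> a p q; set N := maxn (size p) (size q).
have le_pN : (size p <= N)%N by exact: leq_maxl.
have le_qN : (size q <= N)%N by exact: leq_maxr.
have le_N : (size (a *: p + q)%R <= N)%N.
  rewrite (leq_trans (size_polyD _ _)) // geq_max le_qN andbT.
  exact: leq_trans (size_scale_leq _ _) le_pN.
rewrite (umbral_widen _ _ _ le_N) (umbral_widen _ _ _ le_pN).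
rewrite (umbral_widen _ _ _ le_qN) mulr_sumr -big_split /=.
by apply: eq_bigr => i _; rewrite coefD coefZ mulrDl mulrA.
Qed.

HB.instance Definition _ (s : nat -> K) :=
  GRing.isLinear.Build K {poly K} K *%R (umbral s) (umbral_is_linear s).

Lemma umbralXn (s : nat -> K) (k : nat) : umbral s 'X^k = s k.
Proof.
rewrite /umbral size_polyXn big_ord_recr /= coefXn eqxx mul1r big1 ?add0r //.
by move=> i _; rewrite coefXn ltn_eqF // mul0r.
Qed.

Lemma umbral_sign_binM (s : nat -> K) (n k : nat) (p : {poly K}) :
  umbral s ((-1) ^+ k * 'C(n, k)%:R * p) = (-1) ^+ k * 'C(n, k)%:R * umbral s p.
Proof.
by rewrite -linearZ -mul_polyC rmorphM rmorphXn rmorphN rmorph1 rmorph_nat.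
Qed.

Lemma umbral_exp_onesubM (s : nat -> K) (q w : {poly K}) (n : nat) :
  umbral s ((1 - q) ^+ n * w) =
  \sum_(0 <= p < n.+1) (-1) ^+ p * 'C(n, p)%:R * umbral s (q ^+ p * w).
Proof.
rewrite exprBn_nat mulr_suml raddf_sum; apply: eq_bigr => p _.
by rewrite expr1n mul1r -umbral_sign_binM mulrA.
Qed.

(* [L_s (x) L_t], with [x] as the inner variable. *)
Definition umbral2 (s t : nat -> K) (P : {poly {poly K}}) : K :=
  umbral t (map_poly (umbral s) P).

Lemma umbral2_is_zmod_morphism (s t : nat -> K) : zmod_morphism (umbral2 s t).
Proof. by move=> P Q; rewrite /umbral2 !raddfB. Qed.

HB.instance Definition _ (s t : nat -> K) :=
  GRing.isZmodMorphism.Build {poly {poly K}} K (umbral2 s t)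
    (umbral2_is_zmod_morphism s t).

(** Here [a%:P] is a(x) and [b^:P] is b(y). The coefficient of y^i in their product is b_i a(x),
    which [umbral s] sends to b_i L_s(a); the scalar L_s(a) then comes out of [umbral t]. *)
Lemma umbral2M (s t : nat -> K) (a b : {poly K}) :
  umbral2 s t (a%:P * b^:P) = umbral s a * umbral t b.
Proof.
rewrite /umbral2 -[RHS]linearZ; congr (umbral t _); apply/polyP => i.
rewrite coef_map /= coefCM coef_map coefZ /= mulrC mul_polyC linearZ /=.
by rewrite mulrC.
Qed.

(** [umbral2] is declared additive only, so the scalar is absorbed into [a], where the linearity of
    [umbral s] applies. *)
Lemma umbral2_sign_binM (s t : nat -> K) (n k : nat) (a b : {poly K}) :
  umbral2 s t ((-1) ^+ k * 'C(n, k)%:R * (a%:P * b^:P)) =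
  (-1) ^+ k * 'C(n, k)%:R * umbral s a * umbral t b.
Proof.
rewrite -umbral_sign_binM -umbral2M; congr (umbral2 s t _).
by rewrite mulrA !(rmorphM, rmorphXn, rmorphN, rmorph1, rmorph_nat).
Qed.

Lemma umbral2_exp_subl (s t : nat -> K) (n : nat) (a b f g : {poly K}) :
  umbral2 s t ((a%:P - b^:P) ^+ n * (f%:P * g^:P)) =
  \sum_(0 <= k < n.+1) (-1) ^+ k * 'C(n, k)%:R *
     umbral s (a ^+ (n - k) * f) * umbral t (b ^+ k * g).
Proof.
rewrite exprBn_nat mulr_suml raddf_sum; apply: eq_bigr => k _ /=.
rewrite -umbral2_sign_binM; congr (umbral2 s t _).
rewrite -[LHS]mulrA; congr (_ * _).
by rewrite !(rmorphM, rmorphXn) /= mulrACA.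
Qed.

(** Swapping the two terms of the difference moves the exponent [n - k] from the [s] side to the [t]
    side, as on the right of the theorem. *)
Lemma umbral2_exp_subr (s t : nat -> K) (n : nat) (a b f g : {poly K}) :
  umbral2 s t ((b^:P - a%:P) ^+ n * (f%:P * g^:P)) =
  \sum_(0 <= k < n.+1) (-1) ^+ k * 'C(n, k)%:R *
     umbral s (a ^+ k * f) * umbral t (b ^+ (n - k) * g).
Proof.
rewrite exprBn_nat mulr_suml raddf_sum; apply: eq_bigr => k _ /=.
rewrite -umbral2_sign_binM; congr (umbral2 s t _).
rewrite -[LHS]mulrA; congr (_ * _).
by rewrite [_ ^+ (n - k) * _]mulrC !(rmorphM, rmorphXn) /= mulrACA.
Qed.

End Umbral.

Lemma umbral_exp_onesubX (R : realType) (s sigma : nat -> R[i]) :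
  binomial_transform_pair_first_kind s sigma ->
  forall k, umbral s ((1 - 'X) ^+ k) = sigma k.
Proof.
move=> hs k; rewrite hs -[_ ^+ k]mulr1 umbral_exp_onesubM.
by apply: eq_bigr => p _; rewrite mulr1 umbralXn.
Qed.

Theorem theorem13 (R : realType) (m n r u v : nat)
    (s sigma t tau : nat -> R[i])
    (hs : binomial_transform_pair_first_kind s sigma)
    (ht : binomial_transform_pair_first_kind t tau) :
  \sum_(0 <= k < n.+1) (-1) ^+ k * 'C(n, k)%:R *
     (\sum_(0 <= p < r.+1) (-1) ^+ p * 'C(r, p)%:R * s (n - k + p + m)%N) *
     (\sum_(0 <= j < u.+1) (-1) ^+ j * 'C(u, j)%:R * t (k + j + v)%N)
  = \sum_(0 <= k < n.+1) (-1) ^+ k * 'C(n, k)%:R *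
     (\sum_(0 <= p < m.+1) (-1) ^+ p * 'C(m, p)%:R * sigma (k + p + r)%N) *
     (\sum_(0 <= j < v.+1) (-1) ^+ j * 'C(v, j)%:R * tau (n - k + j + u)%N).
Proof.
(* The power of ['X] depending on the outer index is kept in front; the other factor will serve as
   [f] or [g] in [umbral2_exp_subl]. *)
have onesubE (w : nat -> R[i]) (a b c : nat) :
    \sum_(0 <= p < a.+1) (-1) ^+ p * 'C(a, p)%:R * w (b + p + c)%N =
    umbral w ('X^b * ((1 - 'X) ^+ a * 'X^c)).
  rewrite mulrCA umbral_exp_onesubM; apply: eq_bigr => p _.
  by rewrite -!exprD umbralXn addnCA addnA.
have XE (w omega : nat -> R[i]) (a b c : nat) :
    binomial_transform_pair_first_kind w omega ->
    \sum_(0 <= p < a.+1) (-1) ^+ p * 'C(a, p)%:R * omega (b + p + c)%N =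
    umbral w ((1 - 'X) ^+ b * ((1 - 'X) ^+ c * 'X^a)).
  (* Writing x = 1 - (1 - x) lets x^a expand in powers of 1 - x, whose umbral values are the terms
     of [omega]. *)
  have -> : (1 - 'X) ^+ b * ((1 - 'X) ^+ c * 'X^a) =
      (1 - (1 - 'X)) ^+ a * (1 - 'X) ^+ (b + c) :> {poly R[i]}.
    by rewrite subKr exprD mulrA mulrC.
  move=> hw; rewrite umbral_exp_onesubM; apply: eq_bigr => p _.
  by rewrite -exprD (umbral_exp_onesubX _ _ _ hw) addnCA addnA.
under eq_bigr do rewrite !onesubE.
under [RHS]eq_bigr do rewrite (XE _ _ _ _ _ hs) (XE _ _ _ _ _ ht).
(* Both sides now share the cofactors (1 - x)^r x^m and (1 - y)^u y^v, so only x - y = (1 - y) - (1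
   - x) remains. *)
rewrite -umbral2_exp_subl -umbral2_exp_subr; congr (umbral2 s t (_ ^+ n * _)).
by rewrite rmorphB /= rmorph1 rmorphB /= rmorph1 opprB [RHS]addrC addrA subrK.
Qed.
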